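(* Let $m\ge 2$ and $r\ge 1$ be integers and put $d=m+r-1$. Then for every integer $k$ with $1\le k\le d+1$, \[ B_{m,r,k}=[x^{mk-1}]\,(1+x+\cdots+x^{m-1})^{d+1}. \] In particular, $B_{m,r,k}$ is a nonnegative integer.
   Context: For an integer $d\ge 0$, $\binom{Y}{d}$ denotes the polynomial $Y(Y-1)\cdots(Y-d+1)/d!$. For integers $m\ge2$, $r\ge1$ and $d=m+r-1$, the shifted-binomial coordinates $B_{m,r,k}\in\mathbb{Q}$ ($1\le k\le d+1$) are defined as the unique rational numbers satisfying the polynomial identity in $n$ \[ \binom{mn}{d}=\sum_{k=1}^{d+1}B_{m,r,k}\binom{n+k-1}{d} \] (the polynomials $\binom{n+k-1}{d}$, $1\le k\le d+1$, form a basis of the $\mathbb{Q}$-vector space of polynomials of degree at most $d$). $[x^j]F(x)$ denotes the coefficient of $x^j$ in the polynomial $F(x)$ (zero if $j>\deg F$). *)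

(* Defs.v *)
From mathcomp Require Import all_boot all_order all_algebra.

Set Implicit Arguments.
Unset Strict Implicit.
Unset Printing Implicit Defensive.

Import Order.TTheory GRing.Theory Num.Theory.
Local Open Scope ring_scope.

(* Y (Y - 1) ... (Y - d + 1) / d! as a polynomial in Y = 'X *)
Definition binomial_poly (d : nat) : {poly rat} :=
  (d`!%:R)^-1 *: \prod_(i < d) ('X - (i%:R)%:P).

(* The identity binom(m n, d) = \sum_(1 <= k <= d+1) B_k binom(n + k - 1, d)
   in the indeterminate n = 'X; the entry b i is B_(i + 1). *)
Definition shifted_binomial_identity (m d : nat) (b : {ffun 'I_d.+1 -> rat}) :
    bool :=
  binomial_poly d \Po (m%:R *: 'X)
    == \sum_(i < d.+1) b i *: (binomial_poly d \Po ('X + (i%:R)%:P)).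

Lemma horner_binomial_poly d n : (binomial_poly d).[n%:R] = 'C(n, d)%:R.
Proof.
rewrite /binomial_poly hornerZ horner_prod.
have -> : \prod_(i < d) ('X - (i%:R)%:P).[n%:R] = (n ^_ d)%:R :> rat.
  rewrite ffact_prod natr_prod.
  have [le_dn | lt_nd] := leqP d n.
    apply: eq_bigr => i _; rewrite hornerXsubC natrB //.
    exact: leq_trans (ltnW (ltn_ord i)) le_dn.
  rewrite (bigD1 (Ordinal lt_nd)) //= [RHS](bigD1 (Ordinal lt_nd)) //=.
  by rewrite hornerXsubC subrr subnn !mul0r.
by rewrite -bin_ffact natrM mulrC mulfK // pnatr_eq0 -lt0n fact_gt0.
Qed.

Lemma size_binomial_poly d : (size (binomial_poly d) <= d.+1)%N.
Proof.
apply: leq_trans (size_scale_leq _ _) _.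
by rewrite size_prod_XsubC /index_enum -enumT size_enum_ord.
Qed.

Lemma size_binomial_comp d (q : {poly rat}) :
  (size q <= 2)%N -> (size (binomial_poly d \Po q) <= d.+1)%N.
Proof.
move=> sq; apply: leq_trans (size_comp_poly_leq _ _) _; rewrite ltnS.
have le1 : ((size q).-1 <= 1)%N by case: (size q) sq => [|[|[|]]].
apply: leq_trans (leq_mul (leqnn _) le1) _; rewrite muln1.
by have := size_binomial_poly d; case: (size (binomial_poly d)).
Qed.

Lemma poly_eq_on_ord d (p q : {poly rat}) :
    (size p <= d.+1)%N -> (size q <= d.+1)%N ->
  (forall j : 'I_d.+1, p.[(d - j)%:R] = q.[(d - j)%:R]) -> p = q.
Proof.
move=> sp sq eq_pq; apply/eqP; rewrite -subr_eq0; apply/negPn/negP => nz.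
pose rs := [seq (i : nat)%:R : rat | i <- iota 0 d.+1].
have rsroot : all (root (p - q)) rs.
  apply/allP => x /mapP[i]; rewrite mem_iota add0n => /andP[_ lti] ->.
  rewrite /root hornerD hornerN.
  have := eq_pq (rev_ord (Ordinal lti)).
  by rewrite /= subSS subKn // => ->; rewrite subrr.
have urs : uniq rs.
  rewrite map_inj_uniq ?iota_uniq // => x y eq_xy.
  by apply/eqP; rewrite -(eqr_nat rat) eq_xy.
have := max_poly_roots nz rsroot urs.
rewrite size_map size_iota ltnNge => /negP; apply.
apply: leq_trans (size_polyD _ _) _.
by rewrite size_polyN geq_max sp sq.
Qed.

Definition shifted_binomial_mx d : 'M[rat]_d.+1 :=
  \matrix_(i, j) 'C(d - j + i, d)%:R.

Lemma shifted_binomial_mx_unit d : shifted_binomial_mx d \in unitmx.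
Proof.
rewrite unitmxE det_trig.
  rewrite big1 ?unitr1 // => i _.
  by rewrite mxE subnK ?binn // -ltnS.
apply/is_trig_mxP => i j lt_ij; rewrite mxE bin_small //.
have le_jd : (j <= d)%N by rewrite -ltnS.
by rewrite -[X in (_ < X)%N](subnK le_jd) ltn_add2l.
Qed.

Lemma shifted_binomial_identityE m d (b : {ffun 'I_d.+1 -> rat}) :
  shifted_binomial_identity m b =
  (\row_i b i *m shifted_binomial_mx d == \row_j 'C(m * (d - j), d)%:R).
Proof.
have evr (j : 'I_d.+1) :
    (\sum_(i < d.+1) b i *: (binomial_poly d \Po ('X + (i%:R)%:P))).[(d - j)%:R]
    = (\row_i b i *m shifted_binomial_mx d) 0 j.
  rewrite horner_sum mxE; apply: eq_bigr => i _.
  rewrite hornerZ horner_comp hornerD hornerX hornerC -natrD.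
  by rewrite horner_binomial_poly !mxE.
have evl (j : 'I_d.+1) :
    (binomial_poly d \Po (m%:R *: 'X)).[(d - j)%:R]
    = (\row_j 'C(m * (d - j), d)%:R) 0 j :> rat.
  by rewrite horner_comp [(_ *: 'X).[_]]hornerZ hornerX -natrM horner_binomial_poly mxE.
apply/eqP/eqP => [eqp | eqv].
  by apply/rowP => j; rewrite -evr -evl eqp.
apply: (@poly_eq_on_ord d) => [||j].
- apply: size_binomial_comp; apply: leq_trans (size_scale_leq _ _) _.
  by rewrite size_polyX.
- apply: leq_trans (size_sum _ _ _) _; apply/bigmax_leqP => i _.
  apply: leq_trans (size_scale_leq _ _) _.
  by apply: size_binomial_comp; rewrite size_XaddC.
- by rewrite evr evl eqv.
Qed.

Lemma shifted_binomial_exists m d :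
  exists b : {ffun 'I_d.+1 -> rat}, shifted_binomial_identity m b.
Proof.
pose v : 'rV[rat]_d.+1 := \row_j 'C(m * (d - j), d)%:R.
pose w := v *m invmx (shifted_binomial_mx d).
exists [ffun i => w 0 i]; rewrite shifted_binomial_identityE.
have -> : \row_i [ffun i => w 0 i] i = w by apply/rowP => i; rewrite mxE ffunE.
by rewrite mulmxKV ?shifted_binomial_mx_unit.
Qed.

Lemma shifted_binomial_uniq m d (b c : {ffun 'I_d.+1 -> rat}) :
  shifted_binomial_identity m b -> shifted_binomial_identity m c -> b = c.
Proof.
rewrite !shifted_binomial_identityE => /eqP eb /eqP ec.
have /rowP e : \row_i b i = \row_i c i.
  by apply: (can_inj (mulmxK (shifted_binomial_mx_unit d))); rewrite eb ec.
by apply/ffunP => i; have := e i; rewrite !mxE.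
Qed.

(* B_(m,r,k), meaningful for 1 <= k <= d + 1 where d = m + r - 1 *)
Definition B (m r k : nat) : rat :=
  xchoose (shifted_binomial_exists m (m + r - 1)) (inord k.-1).

Lemma B_spec m r (d := (m + r - 1)%N) :
  binomial_poly d \Po (m%:R *: 'X)
  = \sum_(1 <= k < d.+2)
      B m r k *: (binomial_poly d \Po ('X + (k%:R - 1)%:P)).
Proof.
rewrite big_add1 big_mkord.
have /eqP -> := xchooseP (shifted_binomial_exists m d).
by apply: eq_bigr => i _; rewrite /B /= inord_val -natr1 addrK.
Qed.

(* Main.v *)
Require Import Defs.
From mathcomp Require Import all_boot all_order all_algebra.
From mathcomp Require Import ring zify.

Import Order.TTheory GRing.Theory Num.Theory.
Local Open Scope ring_scope.

(** Write A_M for 1 + X + ... + X^(M-1).  Euclidean division by m of the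
    exponents below m N gives the exact factorization
    A_(m N)(X) = A_m(X) A_N(X^m) ([geometric_poly_mul]).  Raise it to the power
    d + 1 and compare the coefficients of X^(m N - 1).  Below X^M, the
    polynomial A_M^(d+1) agrees with the series (1 - X)^-(d+1), so that its
    coefficients there are the binomials binom(j + d, d)
    ([coef_geometric_polyX]); hence, with c_k := [x^(m k - 1)] A_m^(d+1),
      binom(m N - 1 + d, d) = \sum_(1 <= k <= N) c_k binom(N - k + d, d).
    For 1 <= N <= d + 1 the sum may run up to k = d + 1, since the added
    binomials have 0 <= N - k + d < d and vanish.  By the reflection
    binom(d - 1 - y, d) = (-1)^d binom(y, d), this is then the identity
    binom(m n, d) = \sum_k c_k binom(n + k - 1, d) at n = - N.  Both sides are
    polynomials in n of degree at most d that agree at n = -1, ..., -(d+1),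
    hence they are equal ([shifted_binomial_coef]), and the uniqueness of the
    coordinates identifies c_k with B_(m,r,k).  The c_k are natural numbers
    because the coefficients of A_m are. *)

Definition geometric_poly (m : nat) : {poly rat} := \sum_(j < m) 'X^j.

Lemma coef_geometric_poly m i : (geometric_poly m)`_i = (i < m)%:R.
Proof.
rewrite coef_sum; under eq_bigr do rewrite coefXn.
have [lt_im | le_mi] := ltnP i m.
  rewrite (bigD1 (Ordinal lt_im)) //= eqxx big1 ?addr0 // => j.
  by rewrite -val_eqE /= eq_sym => /negPf ->.
by rewrite big1 // => j _; rewrite gtn_eqF // (leq_trans (ltn_ord j)).
Qed.

(** Each exponent below m n is uniquely a + m q with a < m and q < n. *)
Lemma geometric_poly_mul m n :
  geometric_poly (m * n) = geometric_poly m * (geometric_poly n \Po 'X^m).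
Proof.
rewrite /geometric_poly; elim: n => [|n IHn].
  by rewrite muln0 !big_ord0 comp_poly0 mulr0.
rewrite mulnSr big_split_ord /= [in RHS]big_ord_recr /= comp_polyD mulrDr IHn.
congr (_ + _); rewrite comp_Xn_poly -exprM mulr_suml.
by apply: eq_bigr => j _; rewrite -exprD addnC.
Qed.

(** Below X^M, multiplying by [geometric_poly M] takes partial sums of the
    coefficients; the hockey-stick identity does the induction on d. *)
Lemma coef_geometric_polyX M d j :
  (j < M)%N -> (geometric_poly M ^+ d.+1)`_j = 'C(j + d, d)%:R.
Proof.
elim: d j => [|d IHd] j lt_jM.
  by rewrite expr1 coef_geometric_poly lt_jM bin0.
have hockey i : (\sum_(k < i.+1) 'C(k + d, d) = 'C(i + d.+1, d.+1))%N.
  elim: i => [|i IHi]; first by rewrite big_ord1 !add0n !binn.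
  by rewrite big_ord_recr /= IHi addSnnS [in RHS]addSn binS.
rewrite exprSr coefM -hockey natr_sum; apply: eq_bigr => k _.
have le_kj : (k <= j)%N by rewrite -ltnS.
rewrite IHd ?(leq_ltn_trans le_kj) // coef_geometric_poly.
by rewrite (leq_ltn_trans (leq_subr _ _)) // mulr1.
Qed.

(** The bound n serves to fix the number of summands in advance: the terms of
    q from index n on only reach exponents above i. *)
Lemma coefM_comp_Xn (R : comNzRingType) (p q : {poly R}) m n i :
    (i < m * n)%N ->
  (p * (q \Po 'X^m))`_i = \sum_(j < n | (m * j <= i)%N) q`_j * p`_(i - m * j).
Proof.
move=> lt_i; set K := maxn n (size q).
have -> : q \Po 'X^m = \sum_(j < K) q`_j *: 'X^(m * j).
  rewrite comp_polyE (big_ord_widen K (fun j => q`_j *: 'X^m ^+ j)) ?leq_maxr //.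
  rewrite big_mkcond; apply: eq_bigr => j _; rewrite exprM.
  by case: ltnP => // /(nth_default 0) ->; rewrite scale0r.
rewrite (big_ord_widen_cond K (fun j => m * j <= i)%N
  (fun j => q`_j * p`_(i - m * j))) ?leq_maxl //.
rewrite mulr_sumr coef_sum [RHS]big_mkcond; apply: eq_bigr => j _ /=.
rewrite -scalerAr coefZ coefMXn.
have [lt_ij | le_ji] := ltnP i (m * j); first by rewrite mulr0.
case: ltnP => //= le_nj; move: lt_i.
by rewrite ltnNge (leq_trans _ le_ji) // leq_mul2l le_nj orbT.
Qed.

(** The coefficient of X^(m (n + 1) - 1) in the (d + 1)-st power of
    [geometric_poly_mul]. *)
Lemma bin_geometric_coef m d n : (0 < m)%N ->
  'C(m * n.+1 - 1 + d, d)%:R =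
  \sum_(i < n.+1) (geometric_poly m ^+ d.+1)`_(m * i.+1 - 1)
                  * 'C(n - i + d, d)%:R.
Proof.
move=> m_gt0; have mn_gt0 : (0 < m * n.+1)%N by rewrite muln_gt0 m_gt0.
have lt_mn : (m * n.+1 - 1 < m * n.+1)%N by rewrite subn1 prednK.
rewrite -(coef_geometric_polyX _ d _ lt_mn) geometric_poly_mul exprMn.
rewrite -rmorphXn /= (coefM_comp_Xn _ _ _ _ n.+1) //.
rewrite (reindex_inj rev_ord_inj) /=.
apply: eq_big => [i | i _].
  by rewrite subSS subn1 -ltnS prednK // ltn_pmul2l // ltnS leq_subr.
have le_in : (i <= n)%N by rewrite -ltnS.
rewrite subSS coef_geometric_polyX ?ltnS ?leq_subr // mulrC.
congr (_`_ _ * _).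
by rewrite subnAC -mulnBr subSn ?leq_subr // subKn.
Qed.

(** The roots 0, ..., d - 1 of [binomial_poly d] are symmetric under
    y |-> d - 1 - y. *)
Lemma horner_binomial_poly_reflect d x :
  (binomial_poly d).[d%:R - 1 - x] = (-1) ^+ d * (binomial_poly d).[x].
Proof.
rewrite /binomial_poly !hornerZ mulrCA; congr (_ * _); rewrite !horner_prod.
rewrite -[X in (-1) ^+ X]card_ord -prodr_const -big_split /=.
rewrite (reindex_inj rev_ord_inj) /=; apply: eq_bigr => i _.
by rewrite !hornerXsubC /= natrB // -natr1; ring.
Qed.

Lemma horner_binomial_polyN d n :
  (binomial_poly d).[d%:R - 1 - n%:R] = (-1) ^+ d * 'C(n, d)%:R.
Proof. by rewrite horner_binomial_poly_reflect horner_binomial_poly. Qed.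

(** Negative points are used because there all the binomials involved, up to
    sign, have a nonnegative upper argument.  The involution X |-> - X - 1
    moves the interpolation points from 0, ..., d to -1, ..., -(d+1). *)
Lemma poly_eq_on_neg d (p q : {poly rat}) :
    (size p <= d.+1)%N -> (size q <= d.+1)%N ->
  (forall n, (n <= d)%N -> p.[- n.+1%:R] = q.[- n.+1%:R]) -> p = q.
Proof.
move=> sp sq eq_pq; pose s : {poly rat} := - 'X - 1.
have ssz : size s = 2%N by rewrite /s -opprD size_polyN size_XaddC.
have sK : s \Po s = 'X.
  by rewrite {1}/s raddfB raddfN /= comp_polyX -polyC1 comp_polyC /s; ring.
suff eqs : p \Po s = q \Po s.
  by rewrite -[p]comp_polyXr -[q]comp_polyXr -sK !comp_polyA eqs.
apply: (@poly_eq_on_ord d); rewrite ?size_comp_poly2 // => j.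
have evs (t : {poly rat}) : (t \Po s).[(d - j)%:R] = t.[- (d - j).+1%:R].
  by rewrite horner_comp /s !hornerE -natr1 opprD.
by rewrite !evs eq_pq // leq_subr.
Qed.

Lemma shifted_binomial_coef m d : (0 < m)%N ->
  shifted_binomial_identity m
    [ffun i : 'I_d.+1 => (geometric_poly m ^+ d.+1)`_(m * i.+1 - 1)].
Proof.
move=> m_gt0; apply/eqP; apply: (@poly_eq_on_neg d) => [||n le_nd].
- by rewrite size_binomial_comp // (leq_trans (size_scale_leq _ _)) ?size_polyX.
- apply: leq_trans (size_sum _ _ _) _; apply/bigmax_leqP => i _.
  by rewrite (leq_trans (size_scale_leq _ _)) // size_binomial_comp ?size_XaddC.
rewrite horner_comp [(_ *: 'X).[_]]hornerZ hornerX horner_sum.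
have -> : m%:R * - n.+1%:R = d%:R - 1 - (m * n.+1 - 1 + d)%:R :> rat.
  rewrite natrD natrB ?muln_gt0 ?m_gt0 // natrM; ring.
rewrite horner_binomial_polyN bin_geometric_coef // mulr_sumr.
(* On the right, the terms with n < i <= d vanish: up to sign, their binomial
   is binom(n + d - i, d), with 0 <= n + d - i < d. *)
rewrite (big_ord_widen d.+1 (fun i => (-1) ^+ d *
  ((geometric_poly m ^+ d.+1)`_(m * i.+1 - 1) * 'C(n - i + d, d)%:R))) //.
rewrite big_mkcond; apply: eq_bigr => i _.
have le_id : (i <= d)%N by rewrite -ltnS.
rewrite ffunE hornerZ horner_comp hornerD hornerX hornerC.
have -> : - n.+1%:R + i%:R = d%:R - 1 - (n + (d - i))%:R :> rat.
  rewrite natrD natrB // -natr1; ring.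
rewrite horner_binomial_polyN; case: ltnP => [lt_in | le_ni].
  by rewrite addnBA // addnBAC // mulrCA.
by rewrite bin_small ?mulr0 //; lia.
Qed.

Theorem theorem3p1 (m r : nat) (hm : (2 <= m)%N) (hr : (1 <= r)%N) :
  let d := (m + r - 1)%N in
  forall k : nat, (1 <= k <= d + 1)%N ->
    B m r k = ((\sum_(j < m) 'X^j) ^+ (d + 1) : {poly rat})`_(m * k - 1)
    /\ B m r k \is a Num.nat.
Proof.
move=> d k /andP[k_gt0 le_kd].
have BE : B m r k = (geometric_poly m ^+ d.+1)`_(m * k - 1).
  rewrite /B (shifted_binomial_uniq (xchooseP (shifted_binomial_exists m _))
    (shifted_binomial_coef m _ (ltnW hm))) ffunE inordK prednK //.
  by rewrite -addn1.
rewrite BE addn1; split=> //.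
elim: d.+1 (m * k - 1)%N => [|e IHe] i; first by rewrite expr0 coef1 natr_nat.
rewrite exprS coefM rpred_sum // => j _.
by rewrite rpredM // coef_geometric_poly natr_nat.
Qed.
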